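(* Let $d,q$ be integers with $1\le q<d$, $\gcd(d,q)=1$, $X=X(d;1,q)$, and $0\le k<d$. Then $$\mu_X(k)=\begin{cases}-1&\text{if }k=0,\\[4pt] \dfrac{(d-1)+(k-1)(\bar k-1)}{d}-[0,k]\,Q\,[k,0]^t&\text{otherwise.}\end{cases}$$ In particular, for $1\le i\le n$, $\mu_X(q_i)=\mu_{X'}(\bar q_i)=\frac{(d-1)+(q_i-1)(\bar q_i-1)}{d}$, where $X'=X(d;1,\bar q)\cong X$ with $\bar q=\bar q_n$ the inverse of $q$ modulo $d$.
   Context: **Numerical data.** $q_0=d$, $q_1=q$, $q_{i-1}=c_iq_i-q_{i+1}$ with $c_i=\lceil q_{i-1}/q_i\rceil\ge2$, $q_0>q_1>\dots>q_n=1>q_{n+1}=0$. $\bar q_0=0$, $\bar q_{n+1}=d$, and for $1\le i\le n$, $\bar q_i$ is the smallest positive integer with $q\bar q_i\equiv q_i\bmod d$. For $0\le i\le n$ let $X_i=X(q_i;1,q_{i+1})$ and let $(\bar q_{X_i})_j$, $0\le j\le n-i+1$, be the corresponding numbers for $X_i$: $(\bar q_{X_i})_0=0$, $(\bar q_{X_i})_{n-i+1}=q_i$, and for $1\le j\le n-i$, $(\bar q_{X_i})_j$ is the smallest positive integer with $q_{i+1}(\bar q_{X_i})_j\equiv q_{i+j}\bmod q_i$. **Greedy decomposition.** For $0\le k<d$, $[k]=[k_0,\dots,k_{n+1}]$ has $k_0=k_{n+1}=0$ and $k_1,\dots,k_n$ given by successive Euclidean divisions $k=k_1q_1+k_1'$,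 $k_i'=k_{i+1}q_{i+1}+k_{i+1}'$. Put $\bar k=\sum_{i=1}^nk_i\bar q_i$, and let $[0,k]=[0,k_1,\dots,k_n]$ and $[k,0]=[k_1,\dots,k_n,0]$ (row vectors of length $n+1$). **Matrix $Q$.** $Q=(Q_{ij})_{0\le i,j\le n}$ is the upper triangular matrix with $Q_{ij}=0$ if $j<i$ and $Q_{ij}=(\bar q_{X_i})_{j-i+1}$ if $i\le j$. **Newton numbers.** For $X=X(d;1,q)$ let $\mathbb L(k)=\{(r,s)\in\mathbb Z_{\ge0}^2\mid r+qs\equiv k\bmod d\}$, $\mathbb L=\mathbb L(0)$, and let $\Gamma(\mathbb L(k))$ be the convex hull of $\mathbb L(k)$. Then $\mu_X(k):=-1$ if $\mathbb L(k)=\mathbb L$ and $\mu_X(k):=1+\frac{2V-V_1-V_2}{d}$ otherwise, where $V$ is the area of the compact region of the first quadrant between the coordinate axes and $\Gamma(\mathbb L(k))$, and $V_1,V_2$ are the lengths of the intersections of this region with the two coordinate axes. $\mu_{X'}$ is defined in the same way using $X'=X(d;1,\bar q)$, i.e. with $q$ replaced by $\bar q$. *)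

(* Defs.v *)
From HB Require Import structures.
From mathcomp Require Import all_boot all_order all_algebra.
From mathcomp Require Import all_classical all_reals all_analysis.
From mathcomp Require Import complex.

Set Implicit Arguments.
Unset Strict Implicit.
Unset Printing Implicit Defensive.

Import Order.TTheory GRing.Theory Num.Theory.
Import numFieldNormedType.Exports.

Local Open Scope classical_set_scope.
Local Open Scope nat_scope.

Section NumericalData.

Variables d q : nat.

Definition ceil_div (a b : nat) : nat := (a + b.-1) %/ b.

(* q_0 = d, q_1 = q, q_(i+1) = c_i q_i - q_(i-1), where c_i is the round-up of
   q_(i-1) / q_i.  After the first zero q_(n+1) the sequence stays at 0. *)
Fixpoint qseq (i : nat) : nat :=
  if i is i1.+1 then
    if i1 is i2.+1 then ceil_div (qseq i2) (qseq i1) * qseq i1 - qseq i2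
    else q
  else d.

(* The n of the expansion: the first index n with q_(n+1) = 0.  For q < d the
   q_i strictly decrease until they vanish, so that n < d. *)
Definition qlen : nat := find (fun i => qseq i.+1 == 0) (iota 0 d).

(* The smallest positive x with a x = b modulo m, or 0 if there is none; by
   periodicity it suffices to look for x between 1 and m. *)
Definition least_pos_sol (m a b : nat) : nat :=
  head 0 [seq x <- iota 1 m | a * x == b %[mod m]].

Definition qbar (i : nat) : nat :=
  if i == 0 then 0
  else if i == qlen.+1 then d
  else least_pos_sol d q (qseq i).

(* The j-th number attached to X_i = X(q_i; 1, q_(i+1)), for 0 <= i <= n and
   0 <= j <= n - i + 1. *)
Definition qbarX (i j : nat) : nat :=
  if j == 0 then 0
  else if j == (qlen - i).+1 then qseq i
  else least_pos_sol (qseq i) (qseq i.+1) (qseq (i + j)).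

(* The successive remainders k'_i, starting from k'_0 = k. *)
Fixpoint greedy_rem (k i : nat) : nat :=
  if i is i1.+1 then greedy_rem k i1 %% qseq i else k.

Definition greedy (k i : nat) : nat :=
  if 0 < i <= qlen then greedy_rem k i.-1 %/ qseq i else 0.

Definition kbar (k : nat) : nat :=
  \sum_(1 <= i < qlen.+1) greedy k i * qbar i.

Definition Qmx : 'M[int]_qlen.+1 :=
  \matrix_(i, j) Posz (if j < i then 0 else qbarX i (j - i).+1).

(* [0, k] = [0, k_1, .., k_n]; recall that k_0 = 0. *)
Definition zero_greedy (k : nat) : 'rV[int]_qlen.+1 :=
  \row_j Posz (greedy k j).

(* [k, 0] = [k_1, .., k_n, 0]; recall that k_(n+1) = 0. *)
Definition greedy_zero (k : nat) : 'rV[int]_qlen.+1 :=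
  \row_j Posz (greedy k j.+1).

Definition greedy_form (k : nat) : int :=
  (zero_greedy k *m Qmx *m (greedy_zero k)^T)%R ord0 ord0.

Definition LL (k : nat) : set (nat * nat) :=
  [set p | p.1 + q * p.2 = k %[mod d]].

End NumericalData.

Local Open Scope ring_scope.

Definition convex_hull (R : realType) (A : set (R^o * R^o)) : set (R^o * R^o) :=
  smallest (@convex_set R (R^o * R^o)%type) A.

Section NewtonNumber.

Variables (R : realType) (d q k : nat).

Definition Gamma : set (R * R) :=
  convex_hull [set ((p.1)%:R, (p.2)%:R) | p in LL d q k].

(* The closure adds the points of the region lying on the boundary of Gamma,
   which makes the region compact. *)
Definition newton_region : set (R * R) :=
  closure ([set p : R * R | 0 <= p.1 /\ 0 <= p.2] `\` Gamma).

Definition newton_area : R :=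
  fine ((@lebesgue_measure R \x @lebesgue_measure R)%E newton_region).

Definition newton_len1 : R :=
  fine (@lebesgue_measure R [set x | newton_region (x, 0)]).

Definition newton_len2 : R :=
  fine (@lebesgue_measure R [set y | newton_region (0, y)]).

Definition newton_number : R :=
  if `[< LL d q k = LL d q 0 >] then -1
  else 1 + (2 * newton_area - newton_len1 - newton_len2) / d%:R.

End NewtonNumber.

Section CyclicQuotient.

Variable C : fieldType.

(* X(d; 1, q) is the quotient of the affine plane by the d-th roots of unity
   acting by zeta . (x, y) = (zeta x, zeta ^ q y).  Its coordinate ring is the
   ring of invariant polynomials p(x, y), where the coefficients of
   p : {poly {poly C}} are polynomials in x and its variable is y. *)
Definition quotient_ring (d q : nat) : set {poly {poly C}} :=
  [set p | forall zeta x y : C, zeta ^+ d = 1 ->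
     p.[(zeta ^+ q * y)%:P].[zeta * x] = p.[y%:P].[x]].

(* Affine varieties are isomorphic when their coordinate rings are isomorphic
   as C-algebras. *)
Definition quotient_isomorphic (d q d' q' : nat) : Prop :=
  exists2 f : {poly {poly C}} -> {poly {poly C}},
    set_bij (quotient_ring d q) (quotient_ring d' q') f &
    [/\ {in quotient_ring d q &, {morph f : p r / p + r}},
        {in quotient_ring d q &, {morph f : p r / p * r}} &
        forall c : C, f c%:P%:P = c%:P%:P].

End CyclicQuotient.

(* Main.v *)
(* Let P_m = (k'_m, k_1 qbar_1 + ... + k_m qbar_m), where k'_m is the m-th
   remainder of the greedy decomposition. These are points of L(k) running from
   (k, 0) to (0, kbar), and P_(m-1) and P_m lie on a common level line of the
   linear form l_m(r, s) = qbar_m r + q_m s. Since every point of L(k) satisfies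
   l_m >= l_m(P_m), the polygon P_0 ... P_n is the Newton boundary of L(k).
   The lower bound comes from the continued fraction: a point of L(k) determines
   successively a point of the set L(k'_m) of each X_m, and l_m - l_m(P_m) is d
   times the second coordinate of that point. Twice the area under the polygon
   is k kbar minus a sum of the determinants q_i qbar_j - q_j qbar_i, which
   are d times the entries of Q. *)

Require Import Defs.
From HB Require Import structures.
From mathcomp Require Import all_boot all_order all_algebra.
From mathcomp Require Import all_classical all_reals all_analysis.
From mathcomp Require Import complex.
From mathcomp Require Import measurable_realfun.
From mathcomp Require Import ring lra zify.

Set Implicit Arguments.
Unset Strict Implicit.
Unset Printing Implicit Defensive.

Import Order.TTheory GRing.Theory Num.Theory.
Import numFieldNormedType.Exports.

(** * Continued fractions and greedy decompositions *)

Section Arithmetic.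
Local Open Scope nat_scope.

Lemma ceil_div_bounds a b : 0 < b -> a <= ceil_div a b * b < a + b.
Proof.
move=> b0; rewrite /ceil_div; have := divn_eq (a + b.-1) b.
have := ltn_pmod (a + b.-1) b0; lia.
Qed.

(** By coprimality two solutions differ by a multiple of [m], and the range from 1 to [m] is too
    short for two of them. *)
Lemma least_pos_solE m a t x : coprime m a -> 0 < x <= m ->
  a * x = t %[mod m] -> least_pos_sol m a t = x.
Proof.
move=> cma xm axt; rewrite /least_pos_sol; set s := seq.filter _ _.
have xs : x \in s by rewrite mem_filter mem_iota -axt eqxx /=; lia.
have : head 0 s \in s by case: (s) xs => // y s' _; rewrite inE eqxx.
rewrite mem_filter mem_iota -axt => /andP[+ hm].
move: (head 0 s) hm => y hm {s xs axt}.
wlog : x y hm xm / y <= x.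
  move=> W; case: (leqP y x) => yx; first exact: W.
  by rewrite eq_sym => /W-> //; lia.
rewrite eq_sym => yx; rewrite eqn_mod_dvd ?leq_mul// -mulnBr Gauss_dvdr//.
move=> /dvdnP[u]; case: u => [|u]; first by lia.
by rewrite mulSn; lia.
Qed.

Section Recurrence.
Variables d q : nat.

Definition cseq i := ceil_div (qseq d q i.-1) (qseq d q i).

(** The numbers $\bar q_i$ given by the recurrence of the $q_i$, with initial values 0 and 1, so
    that they are open to induction; [qbarE] identifies them with the least solutions of the
    congruences. By [qbarseq_add] the truncated subtraction is exact up to index $n+1$. *)
Fixpoint qbarseq (i : nat) : nat :=
  if i is i1.+1 then
    if i1 is i2.+1 then cseq i1 * qbarseq i1 - qbarseq i2 else 1
  else 0.

Lemma qseqSS i : qseq d q i.+2 = cseq i.+1 * qseq d q i.+1 - qseq d q i.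
Proof. by []. Qed.

Lemma qbarseqSS i : qbarseq i.+2 = cseq i.+1 * qbarseq i.+1 - qbarseq i.
Proof. by []. Qed.

End Recurrence.

(** The expansion of $q_i/q_{i+1}$ is a tail of that of $d/q$, so results about $X$ apply to each
    $X_i$. The recurrence has order two, hence the induction carries two consecutive values. *)
Lemma qseq_shift d q i j :
  qseq (qseq d q i) (qseq d q i.+1) j = qseq d q (i + j).
Proof.
suff : qseq (qseq d q i) (qseq d q i.+1) j = qseq d q (i + j) /\
  qseq (qseq d q i) (qseq d q i.+1) j.+1 = qseq d q (i + j.+1) by case.
elim: j => [|j [IH1 IH2]]; first by rewrite addn0 addn1.
split=> //; rewrite !addnS !qseqSS /cseq -pred_Sn.
by move: IH2; rewrite addnS -pred_Sn IH1 => ->.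
Qed.

Lemma cseq_shift d q i j : 0 < j ->
  cseq (qseq d q i) (qseq d q i.+1) j = cseq d q (i + j).
Proof. by case: j => // j _; rewrite /cseq !qseq_shift addnS. Qed.

(** * Monotonicity, coprimality and determinants of the two sequences *)

Section Sequences.
Variables d q : nat.
Hypotheses (hq : 1 <= q < d) (hdq : coprime d q).
Local Notation n := (qlen d q).
Local Notation q_ := (qseq d q).
Local Notation c_ := (cseq d q).
Local Notation b_ := (qbarseq d q).

Lemma qseq_add i : 0 < q_ i.+1 -> q_ i.+2 + q_ i = c_ i.+1 * q_ i.+1.
Proof. by move=> /(ceil_div_bounds (q_ i)); rewrite qseqSS /cseq /=; lia. Qed.

Lemma qseq_ltS i : 0 < q_ i -> q_ i.+1 < q_ i.
Proof.
case: i => [|i] /=; first by lia.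
by move=> /(ceil_div_bounds (q_ i)); lia.
Qed.

Lemma qseq_eq0S i : q_ i = 0 -> q_ i.+1 = 0.
Proof. by case: i => [|i]; [move=> /=; lia|rewrite qseqSS => ->; lia]. Qed.

(** If no zero occurred in the searched range, strict decrease would give $q_i+i\le d$ for all $i\le
    d$, hence $q_d=0$, a contradiction. After the first zero the sequence stays at zero. *)
Lemma qseq_geq_qlen i : q_ (n + i).+1 = 0.
Proof.
have hs : has (fun i => q_ i.+1 == 0) (iota 0 d).
  apply/negPn/negP => /hasPn nz.
  have pos i0 : i0 < d -> 0 < q_ i0.+1.
    by move=> ?; rewrite lt0n; apply: nz; rewrite mem_iota.
  have bound i0 : i0 <= d -> q_ i0 + i0 <= d.
    elim: i0 => [|i0 IH] hi; first by rewrite addn0.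
    have := IH (ltnW hi).
    have : q_ i0.+1 < q_ i0.
      by apply: qseq_ltS; case: i0 {IH} hi => [|i0] hi /=; [|apply: pos]; lia.
    lia.
  have := bound _ (leqnn d); have := pos d.-1; rewrite prednK; lia.
elim: i => [|i IH]; last by rewrite addnS; exact: qseq_eq0S.
have := nth_find 0 hs; rewrite -/n nth_iota ?addn0 => [/eqP //|].
by move: hs; rewrite has_find size_iota.
Qed.

Lemma qseq_gt0 i : (0 < q_ i) = (i <= n).
Proof.
case: (leqP i n) => [hi|hi]; last first.
  by have := qseq_geq_qlen (i - n.+1); rewrite -addSn subnKC// => ->.
case: i hi => [|i] hi /=; first by lia.
rewrite lt0n; have := @before_find _ 0 (fun i => q_ i.+1 == 0) (iota 0 d) i hi.
rewrite nth_iota ?add0n => [->//|].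
by apply: leq_trans hi _; rewrite -[X in _ <= X](size_iota 0 d) find_size.
Qed.

Lemma qseq_lt i j : i < j -> i <= n -> q_ j < q_ i.
Proof.
move=> ij hi; rewrite -(subnKC ij); elim: (j - i.+1) => [|m IH].
  by rewrite addn0 qseq_ltS// qseq_gt0.
rewrite addnS; case: (posnP (q_ (i.+1 + m))) => [/qseq_eq0S->|/qseq_ltS].
  by rewrite qseq_gt0.
lia.
Qed.

(** A common divisor of $q_{i+1}$ and $q_{i+2}$ divides $q_i$ by the recurrence. *)
Lemma coprime_qseqS i : i <= n -> coprime (q_ i) (q_ i.+1).
Proof.
elim: i => [|i IH] // hi; have := IH (ltnW hi).
rewrite /coprime => /eqP cop; rewrite -dvdn1 -{}cop dvdn_gcd dvdn_gcdl andbT.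
have /qseq_add : 0 < q_ i.+1 by rewrite qseq_gt0.
set g := gcdn _ _ => E.
have : g %| q_ i.+2 + q_ i by rewrite E dvdn_mull// dvdn_gcdl.
by rewrite dvdn_addr// dvdn_gcdr.
Qed.

Lemma qseq_qlen : q_ n = 1.
Proof.
have := coprime_qseqS (leqnn n); have := qseq_geq_qlen 0.
by rewrite addn0 => ->; rewrite /coprime gcdn0 => /eqP.
Qed.

Lemma cseq_gt1 i : i < n -> 1 < c_ i.+1.
Proof.
move=> hi; have /qseq_add : 0 < q_ i.+1 by rewrite qseq_gt0.
have : q_ i.+1 < q_ i by apply: qseq_ltS; rewrite qseq_gt0 ltnW.
by case: (c_ i.+1) => [|[|c]] //; lia.
Qed.

(** Since $c_i\ge2$, the increments of the sequence never decrease, and the first one is 1. *)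
Lemma qbarseq_ltS i : i <= n -> b_ i < b_ i.+1.
Proof.
elim: i => [|i IH] // hi; have := IH (ltnW hi); have := cseq_gt1 hi.
by rewrite qbarseqSS; case: (c_ i.+1) => [|[|c]] // _; rewrite 2!mulSn; lia.
Qed.

Lemma qbarseq_add i : i < n -> b_ i.+2 + b_ i = c_ i.+1 * b_ i.+1.
Proof.
move=> hi; rewrite qbarseqSS subnK//.
have := qbarseq_ltS (ltnW hi); have := cseq_gt1 hi.
by case: (c_ i.+1) => [|c] // _; rewrite mulSn; lia.
Qed.

(** A step of the common recurrence has determinant 1, so the determinant of consecutive pairs keeps
    its initial value $d$. *)
Lemma det_qseq_qbarseqS i : i <= n -> q_ i * b_ i.+1 = q_ i.+1 * b_ i + d.
Proof.
elim: i => [|i IH] hi; first by rewrite muln1 muln0.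
have E := IH (ltnW hi); have Eb := qbarseq_add hi.
have /qseq_add Eq : 0 < q_ i.+1 by rewrite qseq_gt0.
have : q_ i.+1 * (b_ i.+2 + b_ i) = (q_ i.+2 + q_ i) * b_ i.+1.
  by rewrite Eb Eq; lia.
by rewrite mulnDr mulnDl; lia.
Qed.

Lemma qbarseq_qlenS : b_ n.+1 = d.
Proof.
have := det_qseq_qbarseqS (leqnn n); have := qseq_geq_qlen 0.
by rewrite addn0 qseq_qlen => ->; lia.
Qed.

Lemma qbarseq_gt0 i : 0 < i <= n.+1 -> 0 < b_ i.
Proof. by case: i => // i hi; have := @qbarseq_ltS i hi; lia. Qed.

Lemma qbarseq_lt i j : i < j <= n.+1 -> b_ i < b_ j.
Proof.
elim: j => // j IH /andP[]; rewrite ltnS leq_eqVlt => /predU1P[->|ij] hj.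
  exact: qbarseq_ltS.
by apply: ltn_trans (qbarseq_ltS hj); apply: IH; lia.
Qed.

Lemma qbarseq_ltd i : i <= n -> b_ i < d.
Proof.
move=> hi; rewrite -[X in _ < X]qbarseq_qlenS; apply: qbarseq_lt.
by rewrite !ltnS hi leqnn.
Qed.

Lemma qseq_consecutive i : i < n ->
  1 <= q_ i.+1 < q_ i /\ coprime (q_ i) (q_ i.+1).
Proof.
move=> hi; split; last by apply: coprime_qseqS; exact: ltnW.
by apply/andP; split; [rewrite qseq_gt0|rewrite qseq_lt// ltnW].
Qed.

End Sequences.

(** * Determinants of non-consecutive pairs, and the numbers $\bar q_i$ as least solutions *)

Section CrossProducts.
Variables d q : nat.
Hypotheses (hq : 1 <= q < d) (hdq : coprime d q).
Local Notation n := (qlen d q).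
Local Notation q_ := (qseq d q).
Local Notation b_ := (qbarseq d q).

(* Both sides satisfy the recurrence [u_(m+1) = c_(i+m) u_m - u_(m-1)]. *)
Lemma cross_qseq_qbarseq i m : i + m <= n.+1 ->
  q_ i * b_ (i + m) = q_ (i + m) * b_ i + d * qbarseq (q_ i) (q_ i.+1) m.
Proof.
elim/ltn_ind: m => -[|[|m]] IH him; first by rewrite addn0 muln0; lia.
  by rewrite addn1 muln1 det_qseq_qbarseqS; lia.
have E0 := IH m (leqnSn _) ltac:(lia); have E1 := IH m.+1 (leqnn _) ltac:(lia).
rewrite addnS in E1; rewrite !addnS.
have /(qseq_add hq hdq) Eq : 0 < q_ (i + m).+1 by rewrite qseq_gt0//; lia.
have /(qbarseq_add hq hdq) Eb : i + m < n by lia.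
have [hqi hci] := @qseq_consecutive d q hq hdq i ltac:(lia).
have : qbarseq (q_ i) (q_ i.+1) m.+2 + qbarseq (q_ i) (q_ i.+1) m =
    cseq d q (i + m).+1 * qbarseq (q_ i) (q_ i.+1) m.+1.
  rewrite -addnS -cseq_shift// qbarseq_add//.
  by rewrite -qseq_gt0// qseq_shift qseq_gt0//; lia.
move: Eq Eb E0 E1; move: (cseq _ _ _) => c.
move: (qbarseq _ _ m) (qbarseq _ _ m.+1) (qbarseq _ _ m.+2) => x y z.
move: (b_ (i + m)) (b_ (i + m).+1) (b_ (i + m).+2) => b0 b1 b2.
move: (q_ (i + m)) (q_ (i + m).+1) (q_ (i + m).+2) => q0 q1 q2.
move: (q_ i) (b_ i) => p a Eq Eb E0 E1 Ez.
have : p * (b2 + b0) = (q2 + q0) * a + d * (z + x).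
  by rewrite Eb Eq Ez; transitivity (c * (p * b1)); [lia|rewrite E1; lia].
by rewrite !mulnDr mulnDl; lia.
Qed.

(** This is the cross product with index 1, where $q_1=q$ and $\bar q_1=1$. *)
Lemma qseq_qbarseq_mod i : i <= n -> q * b_ i = q_ i %[mod d].
Proof.
case: i => [|i] hi; first by rewrite muln0 modnn mod0n.
have := @cross_qseq_qbarseq 1 i; rewrite add1n muln1 /= => ->; last exact: ltnW.
by rewrite addnC [d * _]mulnC modnMDl.
Qed.

Lemma least_pos_sol_qseq i : 0 < i <= n -> least_pos_sol d q (q_ i) = b_ i.
Proof.
move=> hi; apply: least_pos_solE => //; last by apply: qseq_qbarseq_mod; lia.
by have := @qbarseq_ltd d q hq hdq i; have := @qbarseq_gt0 d q hq hdq i; lia.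
Qed.

Lemma qbarE i : i <= n -> qbar d q i = b_ i.
Proof.
case: i => [|i] // hi; rewrite /qbar eqSS (ltn_eqF hi).
exact: least_pos_sol_qseq.
Qed.

End CrossProducts.

#[local] Arguments qseq : simpl never.
#[local] Arguments qbarseq : simpl never.
#[local] Arguments greedy_rem : simpl never.

(** * Entries of $Q$, the vertices $P_m$ and the area identity *)

Section Greedy.
Variables d q : nat.
Hypotheses (hq : 1 <= q < d) (hdq : coprime d q).
Local Notation n := (qlen d q).
Local Notation q_ := (qseq d q).
Local Notation b_ := (qbarseq d q).

Lemma qbarXE i j : 0 < i -> i < j <= n ->
  qbarX d q i (j - i) = qbarseq (q_ i) (q_ i.+1) (j - i).
Proof.
move=> i0 hij; have [hqi hci] := @qseq_consecutive d q hq hdq i ltac:(lia).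
(* The index [j - i] lies strictly between 0 and $n-i+1$, so neither boundary value of [qbarX] is
   met. *)
rewrite /qbarX ifF ?ifF; [|lia|lia].
rewrite -qseq_shift least_pos_sol_qseq// -qseq_gt0// qseq_shift.
by rewrite subnKC ?qseq_gt0 ?andbT; lia.
Qed.

Lemma cross_qbarX i j : 0 < i -> i < j <= n ->
  q_ i * b_ j = q_ j * b_ i + d * qbarX d q i (j - i).
Proof.
move=> i0 hij; rewrite qbarXE//.
have := @cross_qseq_qbarseq d q hq hdq i (j - i); rewrite subnKC; last lia.
by apply; lia.
Qed.

Variable k : nat.
Hypothesis hk : k < d.
Local Notation rem := (greedy_rem d q k).
Local Notation g := (greedy d q k).

(** The second coordinate of the vertex $P_m$; the first is [greedy_rem d q k m]. *)
Definition height m := \sum_(i < m) g i.+1 * b_ i.+1.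

Lemma heightS m : height m.+1 = height m + g m.+1 * b_ m.+1.
Proof. by rewrite /height big_ord_recr. Qed.

Lemma greedy_remS m : m < n -> rem m = g m.+1 * q_ m.+1 + rem m.+1.
Proof. by move=> hm; rewrite /greedy hm -divn_eq. Qed.

Lemma greedy_rem_lt m : m <= n -> rem m < q_ m.
Proof.
case: m => [|m] hm //; have : 0 < q_ m.+1 by rewrite qseq_gt0.
exact: ltn_pmod.
Qed.

Lemma greedy_rem_qlen : rem n = 0.
Proof. by have := greedy_rem_lt (leqnn n); rewrite qseq_qlen//; lia. Qed.

Lemma height_qlen : height n = kbar d q k.
Proof.
rewrite /kbar big_add1 /= big_mkord; apply: eq_bigr => i _.
by rewrite qbarE// ltn_ord.
Qed.

(** From $P_m$ to $P_{m+1}$ the first coordinate loses $k_{m+1}q_{m+1}$ and the second gains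
    $k_{m+1}\bar q_{m+1}$, which cancels modulo $d$ because $q\bar q_{m+1}\equiv q_{m+1}$. *)
Lemma vertex_LL m : m <= n -> rem m + q * height m = k %[mod d].
Proof.
elim: m => [|m IH] hm; first by rewrite /height big_ord0 muln0 addn0.
rewrite -(IH (ltnW hm)) (greedy_remS hm) heightS mulnDr.
have -> : q * (g m.+1 * b_ m.+1) = g m.+1 * (q * b_ m.+1) by lia.
rewrite addnA -modnDmr -modnMmr qseq_qbarseq_mod// modnMmr modnDmr.
by congr (_ %% _); lia.
Qed.

Lemma vertex_on_edge m : m < n ->
  b_ m.+1 * rem m + q_ m.+1 * height m =
  b_ m.+1 * rem m.+1 + q_ m.+1 * height m.+1.
Proof. by move=> hm; rewrite (greedy_remS hm) heightS; lia. Qed.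

(* [(r, t)] is the point of the set L(k'_m) of X_m determined by [(r, s)]. *)
Lemma LL_descent r s m : LL d q k (r, s) -> m <= n ->
  exists t, b_ m * r + q_ m * s = b_ m * rem m + q_ m * height m + d * t /\
            r + q_ m.+1 * t = rem m %[mod q_ m].
Proof.
move=> Lrs; elim: m => [|m IH] hm.
  by exists s; rewrite /height big_ord0 muln0 !mul0n.
have [t [Et Lt]] := IH (ltnW hm).
(* The left side is congruent to [rem m] modulo $q_m$, and [rem m] is less than $q_m$, so it is the
   remainder and the quotient is the new coordinate. *)
have [t' Et'] : exists t', r + q_ m.+1 * t = rem m + q_ m * t'.
  exists ((r + q_ m.+1 * t) %/ q_ m).
  rewrite [LHS](divn_eq _ (q_ m)) Lt modn_small ?greedy_rem_lt 1?ltnW//; lia.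
have qm : 0 < q_ m by rewrite qseq_gt0// ltnW.
have qm1 : 0 < q_ m.+1 by rewrite qseq_gt0.
have det := det_qseq_qbarseqS hq hdq (ltnW hm).
exists t'; split.
- rewrite -vertex_on_edge//; apply/eqP; rewrite -(eqn_pmul2l qm); apply/eqP.
  (* The determinant $d$ expresses $q_m$ times the form $l_{m+1}$ as $dx+q_{m+1}l_m$, which brings
     in the induction hypothesis. *)
  have E1 x y : q_ m * (b_ m.+1 * x + q_ m.+1 * y) =
      d * x + q_ m.+1 * (b_ m * x + q_ m * y).
    by rewrite mulnDr !mulnA det; lia.
  rewrite E1 [RHS]mulnDr E1 Et; move: (b_ m * _ + _) => C.
  have -> : q_ m * (d * t') = d * (q_ m * t') by lia.
  have -> : d * r + q_ m.+1 * (C + d * t) = d * (r + q_ m.+1 * t) + q_ m.+1 * C.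
    by lia.
  by rewrite Et'; lia.
(* Modulo $q_{m+1}$ the recurrence gives $q_{m+2}\equiv-q_m$, so adding $q_{m+2}t'$ undoes
   $q_mt'$. *)
- have -> : rem m.+1 = rem m %% q_ m.+1 by [].
  rewrite modn_mod.
  have Eq := qseq_add hq hdq qm1.
  rewrite -(modnMDl t) -(modnMDl (cseq d q m.+1 * t') (rem m)).
  by congr (_ %% _); rewrite mulnAC -Eq mulnDl; lia.
Qed.

Lemma LL_above_edge r s m : LL d q k (r, s) -> m <= n ->
  b_ m * rem m + q_ m * height m <= b_ m * r + q_ m * s.
Proof. by move=> Lrs /(LL_descent Lrs)[t [-> _]]; rewrite leq_addr. Qed.

Lemma sum_greedy_qseq m : m <= n ->
  k = \sum_(i < m) g i.+1 * q_ i.+1 + rem m.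
Proof.
elim: m => [|m IH] hm; first by rewrite big_ord0.
by rewrite big_ord_recr [LHS](IH (ltnW hm)) (greedy_remS hm) /= addnA.
Qed.

(** Expand $k$ in its greedy digits and apply [cross_qbarX] to each term: the defect of
    $l_{m+1}(P_m)$ from $l_{m+1}(P_0)$ is $d$ times an entry of $[0,k]\,Q$. *)
Lemma greedy_cross m : m < n ->
  d * \sum_(i < m) g i.+1 * qbarX d q i.+1 (m - i) +
    (q_ m.+1 * height m + b_ m.+1 * rem m) = b_ m.+1 * k.
Proof.
move=> hm; rewrite [in RHS](sum_greedy_qseq (ltnW hm)) mulnDr addnA.
congr (_ + _); rewrite /height !big_distrr -big_split /=.
apply: eq_bigr => i _; have := ltn_ord i => him.
have := @cross_qbarX i.+1 m.+1 isT ltac:(lia).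
rewrite subSS => E.  transitivity (g i.+1 * (q_ i.+1 * b_ m.+1)); last lia.
by rewrite E; lia.
Qed.

Definition greedy_sum m :=
  \sum_(j < m) (\sum_(i < j) g i.+1 * qbarX d q i.+1 (j - i)) * g j.+1.

(** The first sum is twice the area under the path from $P_0$ to $P_m$, cut into trapezoids of width
    $k_jq_j$. The increment from [m] to [m.+1] is [greedy_cross] multiplied by $k_{m+1}$. *)
Lemma area_identity m : m <= n ->
  \sum_(j < m) g j.+1 * q_ j.+1 * (height j + height j.+1) +
    d * greedy_sum m + rem m * height m = k * height m.
Proof.
elim: m => [|m IH] hm; first by rewrite /greedy_sum /height !big_ord0; lia.
have := IH (ltnW hm); have := congr1 (muln (g m.+1)) (greedy_cross hm).
rewrite /greedy_sum [X in _ -> _ -> X + _ + _ = _]big_ord_recr.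
rewrite [X in _ -> _ -> _ + _ * X + _ = _]big_ord_recr /= (greedy_remS hm).
rewrite !heightS; lia.
Qed.

(** The entries $k_0=k_{n+1}=0$ remove the first row and the last column of $Q$; after this shift,
    triangularity leaves exactly the terms with [i < j]. *)
Lemma greedy_formE : greedy_form d q k = Posz (greedy_sum n).
Proof.
have g0 : g 0 = 0 by [].
have gn : g n.+1 = 0 by rewrite /greedy ltnn andbF.
rewrite /greedy_form mxE /greedy_sum (big_morph Posz PoszD (erefl _)).
rewrite big_ord_recr /= !mxE gn mulr0 addr0; apply: eq_bigr => j _.
rewrite !mxE PoszM; congr (_ * _)%R.
rewrite big_ord_recl !mxE g0 mul0r add0r (big_morph Posz PoszD (erefl _)).
rewrite (big_ord_widen _ (fun i => Posz (g i.+1 * qbarX d q i.+1 (j - i)))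
  (ltnW (ltn_ord j))).
rewrite [RHS]big_mkcond; apply: eq_bigr => i _; rewrite !mxE /= /bump add1n.
rewrite ltnS leqNgt.
by case: (ltnP i j) => ij; rewrite /= ?subnSK ?PoszM ?mulr0.
Qed.

End Greedy.

End Arithmetic.

(** * The region below a convex polygon *)

Section Geometry.
Local Open Scope classical_set_scope.
Local Open Scope ring_scope.

(** * Convex sets of the plane in coordinates *)

Section ConvexPlane.
Variable R : realType.
Implicit Types (A : set (R^o * R^o)) (p z : R * R).

Lemma convex_set_plane A : @convex_set R (R^o * R^o)%type A <->
  forall p z t, 0 <= t <= 1 -> A p -> A z ->
    A (t * p.1 + (1 - t) * z.1, t * p.2 + (1 - t) * z.2).
Proof.
split=> [cA p z t /andP[t0 t1] Ap Az|cA p z t].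
  by have /set_mem := cA p z (Itv01 t0 t1) (mem_set Ap) (mem_set Az).
move=> /set_mem Ap /set_mem Az; apply/mem_set.
by have := cA p z t%:num _ Ap Az; apply; apply/andP; split.
Qed.

Lemma convex_segment A x1 y1 x2 y2 x y :
  @convex_set R (R^o * R^o)%type A -> A (x1, y1) -> A (x2, y2) ->
  x1 < x2 -> x1 <= x <= x2 ->
  (x2 - x1) * y = (x - x1) * y2 + (x2 - x) * y1 -> A (x, y).
Proof.
move=> /convex_set_plane cA A1 A2 x12 hx E.
have x120 : 0 < x2 - x1 by rewrite subr_gt0.
have hn : x2 - x1 != 0 by rewrite gt_eqF.
have ht : 0 <= (x - x1) / (x2 - x1) <= 1.
  rewrite divr_ge0 ?subr_ge0 ?(ltW x12) ?ler_pdivrMr ?mul1r ?lerD2r//; lra.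
have := cA (x2, y2) (x1, y1) _ ht A2 A1; congr A; congr pair => /=.
  by field.
by apply: (mulfI hn); rewrite E; field.
Qed.

Lemma convex_horizontal A x1 x2 x y :
  @convex_set R (R^o * R^o)%type A -> A (x1, y) -> A (x2, y) ->
  x1 <= x <= x2 -> A (x, y).
Proof.
move=> cA A1 A2 x12; have [lt12|le21] := ltP x1 x2.
  by apply: (convex_segment cA A1 A2 lt12 x12); ring.
by have -> : x = x1 by lra.
Qed.

Lemma convex_vertical A x y1 y2 y :
  @convex_set R (R^o * R^o)%type A -> A (x, y1) -> A (x, y2) ->
  y1 <= y <= y2 -> A (x, y).
Proof.
move=> /convex_set_plane cA A1 A2 /andP[y1y yy2].
have [y12|y21] := ltP y1 y2; last first.
  by rewrite (_ : y = y1)//; apply/eqP; rewrite eq_le y1y (le_trans yy2).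
have hn : y2 - y1 != 0 by rewrite gt_eqF// subr_gt0.
have ht : 0 <= (y - y1) / (y2 - y1) <= 1.
  rewrite divr_ge0 ?ler_pdivrMr ?subr_gt0//; lra.
have := cA (x, y2) (x, y1) _ ht A2 A1; congr A; congr pair => /=; by field.
Qed.

End ConvexPlane.

(** * Convex hull of a set with a given polygonal boundary, and the area under it *)

Section Polygon.
Variable R : realType.
Variables (S : set (R * R)) (D : R) (n : nat) (X Y a b : nat -> R).
(* [(b m, a m)] is normal to the edge from vertex [m] to vertex [m.+1]. *)
Let c m := b m * X m + a m * Y m.

Hypothesis D_gt0 : 0 < D.
Hypothesis S_ge0 : forall p, S p -> 0 <= p.1 /\ 0 <= p.2.
Hypothesis S_shift1 : forall x y, S (x, y) -> S (x + D, y).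
Hypothesis S_shift2 : forall x y, S (x, y) -> S (x, y + D).
Hypothesis S_vertex : forall m, (m <= n)%N -> S (X m, Y m).
Hypothesis S_above : forall p m, S p -> (m < n)%N ->
  c m <= b m * p.1 + a m * p.2.
Hypothesis n_gt0 : (0 < n)%N.
Hypotheses (Y0 : Y 0 = 0) (Xn : X n = 0).
Hypothesis X_anti : forall m, (m < n)%N -> X m.+1 <= X m.
Hypothesis a_gt0 : forall m, (m < n)%N -> 0 < a m.
Hypothesis b_gt0 : forall m, (m < n)%N -> 0 < b m.
Hypothesis c_gt0 : forall m, (m < n)%N -> 0 < c m.
Hypothesis edge : forall m, (m < n)%N -> b m * X m.+1 + a m * Y m.+1 = c m.

Lemma S_shiftn1 x y i : S (x, y) -> S (x + D *+ i, y).
Proof.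
move=> Sxy; elim: i => [|i IH]; first by rewrite mulr0n addr0.
by rewrite mulrSr addrA; exact: S_shift1.
Qed.

Lemma S_shiftn2 x y i : S (x, y) -> S (x, y + D *+ i).
Proof.
move=> Sxy; elim: i => [|i IH]; first by rewrite mulr0n addr0.
by rewrite mulrSr addrA; exact: S_shift2.
Qed.

Lemma archi_shift (x u : R) : exists i, u <= x + D *+ i.
Proof.
have [i hi] : exists i : nat, (u - x) / D <= i%:R.
  exists (Num.truncn `|(u - x) / D|).+1.
  by rewrite (le_trans (ler_norm _))// ltW// truncnS_gt.
by exists i; rewrite -lerBlDl -mulr_natl -ler_pdivrMr.
Qed.

(** Translates of the point by multiples of [D] go arbitrarily far right and up; fill in horizontal
    segments first, then a vertical one between two of these rows. *)
Lemma convex_quadrant (C : set (R^o * R^o)) x y u v :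
  @convex_set R (R^o * R^o)%type C -> S `<=` C ->
  S (x, y) -> x <= u -> y <= v -> C (u, v).
Proof.
move=> cC SC Sxy xu yv.
have row w : S (x, w) -> C (u, w).
  move=> Sxw; have [i hi] := archi_shift x u.
  apply: (convex_horizontal (x1 := x) (x2 := x + D *+ i) cC).
  - exact: SC.
  - by apply: SC; exact: S_shiftn1.
  - by rewrite xu.
have [i hi] := archi_shift y v.
apply: (convex_vertical (y1 := y) (y2 := y + D *+ i) cC).
- exact: row.
- by apply: row; exact: S_shiftn2.
- by rewrite yv.
Qed.

Definition above : set (R * R) :=
  [set p | 0 <= p.1 /\ 0 <= p.2 /\
    forall m, (m < n)%N -> c m <= b m * p.1 + a m * p.2].

Lemma convex_above : @convex_set R (R^o * R^o)%type above.
Proof.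
apply/convex_set_plane => p z t /andP[t0 t1] [p1 [p2 hp]] [z1 [z2 hz]] /=.
have t'0 : 0 <= 1 - t by rewrite subr_ge0.
split; [|split=> [|m hm]]; [by rewrite addr_ge0 ?mulr_ge0..|].
have hu := ler_wpM2l t0 (hp m hm); have hv := ler_wpM2l t'0 (hz m hm).
by rewrite /=; lra.
Qed.

Lemma strip_index x : 0 <= x < X 0 -> exists2 m, (m < n)%N & X m.+1 <= x < X m.
Proof.
move=> /andP[x0 xX]; have exm : exists m, X m <= x by exists n; rewrite Xn.
case: (ex_minnP exm) => -[|m] hm min; first by move: xX; rewrite ltNge hm.
exists m; first by apply: min; rewrite Xn.
by rewrite hm ltNge; apply/negP => /min; rewrite ltnn.
Qed.

Lemma convex_hull_polygon : convex_hull S = above.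
Proof.
apply/seteqP; split.
  apply: smallest_sub; first exact: convex_above.
  move=> p Sp; have [p1 p2] := S_ge0 Sp.
  by split=> //; split=> // m; exact: S_above.
move=> [x y] [/= x0 [y0 hxy]] C [cC SC].
have [Xx|xX] := leP (X 0) x.
  by apply: (convex_quadrant cC SC (S_vertex (leq0n n))); rewrite ?Y0.
have [m hm /andP[Xmx xXm]] := @strip_index x (introT andP (conj x0 xX)).
have am := a_gt0 hm; have hxym := hxy m hm; have em := edge hm.
(* The vertical distance from the edge to the point. Raising the edge by [e] makes it pass through
   the point, and its raised endpoints lie in the quadrants over two vertices. *)
pose e := y - (c m - b m * x) / a m.
have Ea : (c m - b m * x) / a m * a m = c m - b m * x by field; rewrite gt_eqF.
have e0 : 0 <= e by rewrite subr_ge0 ler_pdivrMr//; lra.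
have Cv i w : (i <= n)%N -> w = Y i + e -> C (X i, w).
  move=> hi ->.
  by apply: (convex_quadrant cC SC (S_vertex hi)); rewrite // lerDl.
apply: (convex_segment cC (Cv _ _ hm erefl) (Cv _ _ (ltnW hm) erefl)).
- lra.
- by rewrite Xmx ltW.
have hn : a m != 0 by rewrite gt_eqF.
have EY : Y m = (c m - b m * X m) / a m by rewrite /c; field.
have EY1 : Y m.+1 = (c m - b m * X m.+1) / a m by rewrite -em; field.
by rewrite EY EY1 /e; field.
Qed.

(** The closed counterpart of the complement of [above]: edges are included, and one inequality
    suffices. *)
Definition below : set (R * R) :=
  [set p | 0 <= p.1 /\ 0 <= p.2 /\
    exists2 m, (m < n)%N & b m * p.1 + a m * p.2 <= c m].

Lemma belowE : below = [set p | 0 <= p.1] `&` [set p | 0 <= p.2] `&`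
  \bigcup_(m in `I_n) [set p | b m * p.1 + a m * p.2 <= c m].
Proof.
apply/seteqP; split=> p /=.
  by move=> [p1 [p2 [m hm h]]]; split=> //; exists m.
by move=> [[p1 p2] [m hm h]]; split=> //; split=> //; exists m.
Qed.

Lemma closed_below : closed below.
Proof.
have cle (f : R * R -> R) y : continuous f -> closed [set p | f p <= y].
  by move=> cf; apply: (@preimage_closed _ _ f [set x | x <= y]) => [p _|];
    [exact: cf|exact: closed_le].
have cge (f : R * R -> R) y : continuous f -> closed [set p | y <= f p].
  by move=> cf; apply: (@preimage_closed _ _ f [set x | y <= x]) => [p _|];
    [exact: cf|exact: closed_ge].
rewrite belowE; apply: closedI; first apply: closedI.
- by apply: (cge fst) => p; exact: cvg_fst.
- by apply: (cge snd) => p; exact: cvg_snd.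
apply: closed_bigcup => // m _; apply: cle => p.
apply: cvgD; apply: cvgM; first exact: cvg_cst.
- exact: cvg_fst.
- exact: cvg_cst.
- exact: cvg_snd.
Qed.

Lemma measurable_below : measurable below.
Proof.
rewrite belowE.
have mle (f : R * R -> R) (g : R * R -> R) : measurable_fun setT f ->
    measurable_fun setT g -> measurable [set p | f p <= g p].
  by move=> mf mg; rewrite -[X in measurable X]setTI; exact: measurable_fun_le.
apply: measurableI; first apply: measurableI.
- exact: mle.
- exact: mle.
apply: bigcup_measurable => m _; apply: mle => //.
by apply: measurable_funD; apply: measurable_funM.
Qed.

Lemma closure_below_polygon :
  closure ([set p : R * R | 0 <= p.1 /\ 0 <= p.2] `\` convex_hull S) = below.
Proof.
rewrite convex_hull_polygon; apply/seteqP; split.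
  rewrite [X in _ `<=` X](closure_id _).1; last exact: closed_below.
  apply: closure_subset => p [/= [p1 p2] np]; split=> //; split=> //.
  apply: contrapT => h; apply: np; split=> //; split=> // m hm.
  by rewrite leNgt; apply/negP => /ltW hlt; apply: h; exists m.
move=> [x y] [/= x0 [y0 [m hm h]]] B /nbhs_ballP[r /= r0 rB].
(* Shrinking the point towards the origin makes the inequality strict, since
   [c m > 0]. *)
pose e := r / (r + 1 + x + y).
have D0 : 0 < r + 1 + x + y by lra.
have e0 : 0 < e by rewrite divr_gt0.
have e1 : e < 1 by rewrite ltr_pdivrMr//; lra.
have Ee : e * (r + 1 + x + y) = r by rewrite /e; field; rewrite gt_eqF.
exists ((1 - e) * x, (1 - e) * y); split.
  split=> /=; first by split; nra.
  move=> [_ [_ /(_ m hm)/=]]; have := c_gt0 hm; nra.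
apply: rB; split => /=; rewrite /ball /= ger0_norm; nra.
Qed.

Lemma c_le_X0 m : (m < n)%N -> c m <= b m * X 0.
Proof.
move=> hm; have := S_above (S_vertex (leq0n n)) hm.
by rewrite /= Y0 mulr0 addr0.
Qed.

Lemma c_le_Yn m : (m < n)%N -> c m <= a m * Y n.
Proof.
move=> hm; have := S_above (S_vertex (leqnn n)) hm.
by rewrite /= Xn mulr0 add0r.
Qed.

(** Edge 0 starts at [(X 0, 0)], and by [c_le_X0] no edge line meets the axis further out. *)
Lemma below_axis1 : [set x | below (x, 0)] = `[0, X 0]%classic.
Proof.
apply/seteqP; split=> x /=; rewrite in_itv /=.
  move=> [/= x0 [_ [m hm]]]; rewrite mulr0 addr0 x0 /= => h.
  by rewrite -(ler_pM2l (b_gt0 hm)) (le_trans h)// c_le_X0.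
move=> /andP[x0 xX]; split=> //; split=> //; exists 0%N => //=.
by rewrite mulr0 addr0 /c Y0 mulr0 addr0 ler_pM2l// b_gt0.
Qed.

Lemma below_axis2 : [set y | below (0, y)] = `[0, Y n]%classic.
Proof.
apply/seteqP; split=> y /=; rewrite in_itv /=.
  move=> [_ [/= y0 [m hm]]]; rewrite mulr0 add0r y0 /= => h.
  by rewrite -(ler_pM2l (a_gt0 hm)) (le_trans h)// c_le_Yn.
have hm : (n.-1 < n)%N by rewrite prednK.
move=> /andP[y0 yY]; split=> //; split=> //; exists n.-1 => //=.
by rewrite mulr0 add0r -(edge hm) prednK// Xn mulr0 add0r ler_pM2l// a_gt0.
Qed.

Lemma measure_itv0 (x : R) : 0 <= x -> lebesgue_measure `[0, x]%classic = x%:E.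
Proof.
move=> x0; rewrite lebesgue_measure_itv /= lte_fin.
case: ltP => [_|x1]; first by rewrite oppr0 adde0.
by congr EFin; apply/eqP; rewrite eq_le x0 x1.
Qed.

(** Over its own strip edge [m] bounds the section: its points lie in the hull, hence on or above
    the line of every other edge. *)
Lemma below_section m x : (m < n)%N -> X m.+1 <= x <= X m ->
  xsection below x = `[0, (c m - b m * x) / a m]%classic.
Proof.
move=> hm /andP[x1 x2]; have am := a_gt0 hm.
have x0 : 0 <= x.
  by have [/= h _] := S_ge0 (S_vertex hm); exact: le_trans h _.
apply/seteqP; split=> y; rewrite /xsection /= in_itv /=; last first.
  move=> /andP[y0 hy]; apply/mem_set; split=> //; split=> //; exists m => //=.
  by move: hy; rewrite ler_pdivlMr//; lra.
  move=> /set_mem[/= _ [y0 [j hj hjy]]]; rewrite y0 ler_pdivlMr//=.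
  have hn : a m != 0 by rewrite gt_eqF.
  have in_above i : (i <= n)%N -> above (X i, Y i).
    rewrite -convex_hull_polygon => hi.
    by apply: sub_gen_smallest; exact: S_vertex.
  have EY : Y m = (c m - b m * X m) / a m by rewrite /c; field.
  have EY1 : Y m.+1 = (c m - b m * X m.+1) / a m by rewrite -(edge hm); field.
  have : above (x, (c m - b m * x) / a m).
    have [lt|ge] := ltP (X m.+1) (X m).
      apply: (convex_segment convex_above (in_above _ hm)
        (in_above _ (ltnW hm)) lt).
        by rewrite x1.
      by rewrite EY EY1; field.
    have -> : x = X m by apply/eqP; rewrite eq_le x2 (le_trans ge).
    by rewrite -EY; apply: in_above; exact: ltnW.
  move=> [_ [_ /(_ j hj)]] /= h.
  by rewrite -ler_pdivlMr// -(ler_pM2l (a_gt0 hj)); lra.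
Qed.

Lemma below_section_out x : ~ (0 <= x <= X 0) -> xsection below x = set0.
Proof.
move=> hx; apply/seteqP; split=> // y.
rewrite /xsection /= => /set_mem[/= x0 [y0 [m hm h]]].
apply: hx; rewrite x0 /= -(ler_pM2l (b_gt0 hm)) (le_trans _ (c_le_X0 hm))//.
by rewrite (le_trans _ h)// lerDl mulr_ge0// ltW// a_gt0.
Qed.

Lemma integral_trapezoid m : (m < n)%N ->
  (\int[lebesgue_measure]_(x in `]X m.+1, X m])
     lebesgue_measure (xsection below x) =
   ((X m - X m.+1) * (Y m + Y m.+1) / 2)%:E)%E.
Proof.
move=> hm; have am := a_gt0 hm; have an : a m != 0 by rewrite gt_eqF.
have bm := b_gt0 hm.
(* Vertices may coincide, as happens for a zero greedy digit; the strip is then empty. *)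
have [lt|ge] := ltP (X m.+1) (X m); last first.
  rewrite set_itv_ge ?integral_set0; last by rewrite bnd_simp -leNgt.
  have -> : X m = X m.+1 by apply/eqP; rewrite eq_le ge X_anti.
  by rewrite subrr !mul0r.
pose f x := (c m - b m * x) / a m.
pose F x := (c m * x - b m * x ^+ 2 / 2) / a m.
have Y1 : 0 <= Y m.+1 by have [] := S_ge0 (S_vertex hm).
have Y2 : 0 <= Y m by have [] := S_ge0 (S_vertex (ltnW hm)).
have cf : continuous (f : R -> R).
  move=> x; apply: cvgM; last exact: cvg_cst.
  by apply: cvgB; [exact: cvg_cst|apply: cvgM; [exact: cvg_cst|exact: cvg_id]].
have dF (x : R) : is_derive x 1 F (f x).
  rewrite /F /f; apply: is_derive_eq.
  by rewrite /GRing.scale /=; field.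
transitivity (\int[lebesgue_measure]_(x in `]X m.+1, X m]) (f x)%:E)%E.
  apply: eq_integral => x; rewrite inE /= in_itv /= => /andP[x1 x2].
  rewrite (below_section hm) ?(ltW x1)// measure_itv0// divr_ge0 ?(ltW am)//.
  have em := edge hm; have : 0 <= a m * Y m by rewrite mulr_ge0// ltW.
  by move=> ?; have := ler_wpM2l (ltW bm) x2; rewrite /c; lra.
rewrite integral_itv_obnd_cbnd; last first.
  apply/measurable_EFinP; apply: measurable_funTS.
  exact: continuous_measurable_fun.
rewrite (continuous_FTC2 (F := F))//.
- rewrite -EFinB; congr EFin; rewrite /F.
  have EY : Y m = (c m - b m * X m) / a m by rewrite /c; field.
  have EY1 : Y m.+1 = (c m - b m * X m.+1) / a m by rewrite -(edge hm); field.
  by rewrite EY EY1; field.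
- exact: continuous_subspaceT.
- split=> [x _||]; [exact: ex_derive| |];
    [apply: cvg_at_right_filter|apply: cvg_at_left_filter];
    apply: differentiable_continuous; apply/derivable1_diffP; exact: ex_derive.
- by move=> x _; rewrite derive1E derive_val.
Qed.

(** The product measure integrates the lengths of the vertical sections. Half-open strips are
    disjoint and add up from right to left; the missing line over 0 has measure zero. *)
Lemma area_below : ((@lebesgue_measure R \x @lebesgue_measure R) below =
  (\sum_(m < n) (X m - X m.+1) * (Y m + Y m.+1) / 2)%:E)%E.
Proof.
have mg := measurable_fun_xsection (@lebesgue_measure R) measurable_below.
have strips m : (m <= n)%N ->
  (\int[lebesgue_measure]_(x in `]X m, X 0])
     lebesgue_measure (xsection below x) =
   (\sum_(j < m) (X j - X j.+1) * (Y j + Y j.+1) / 2)%:E)%E.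
  elim: m => [|m IH] hm.
    by rewrite set_itv_ge ?integral_set0 ?big_ord0// bnd_simp ltxx.
  have X0m i : (i <= n)%N -> X i <= X 0.
    elim: i => // i IHi hi; exact: le_trans (X_anti hi) (IHi (ltnW hi)).
  have -> : [set` `]X m.+1, X 0]] = `]X m.+1, X m] `|` `]X m, X 0].
    by rewrite -itv_bndbnd_setU// bnd_simp ?X_anti ?X0m// ltnW.
  rewrite ge0_integral_setU//=.
  - rewrite integral_trapezoid// IH; last exact: ltnW.
    by rewrite -EFinD big_ord_recr /= addrC.
  - exact: measurable_funTS.
  - apply/disj_setPLR => x /=; rewrite !in_itv /= => /andP[_ h1].
    by rewrite ltNge h1.
rewrite /product_measure1 -[RHS](strips n)// Xn.
rewrite integral_itv_obnd_cbnd; last exact: measurable_funTS.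
rewrite [RHS]integral_mkcond; apply: eq_integral => x _; rewrite patchE /=.
case: ifPn => //; rewrite notin_setE /= in_itv /= => hx.
by rewrite below_section_out ?measure0//; apply/negP.
Qed.

End Polygon.
Lemma LL_shift1 d q k r s : LL d q k (r, s) -> LL d q k ((r + d)%N, s).
Proof. by rewrite /LL /= addnAC modnDr. Qed.

Lemma LL_shift2 d q k r s : LL d q k (r, s) -> LL d q k (r, (s + d)%N).
Proof.
by rewrite /LL /= => <-; rewrite -[RHS](modnMDl q); congr (_ %% _)%N; lia.
Qed.

(** * The Newton number from the vertices of an integral polygon *)

Section NewtonNumber.
Variables (R : realType) (d q k n : nat) (X Y a b : nat -> nat).
Local Open Scope nat_scope.
Hypothesis d_gt0 : 0 < d.
Hypothesis k_neq0 : k != 0 %[mod d].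
Hypothesis vertex : forall m, m <= n -> LL d q k (X m, Y m).
Hypothesis supp : forall r s m, LL d q k (r, s) -> m < n ->
  b m * X m + a m * Y m <= b m * r + a m * s.
Hypotheses (Y0 : Y 0 = 0) (Xn : X n = 0).
Hypothesis X_anti : forall m, m < n -> X m.+1 <= X m.
Hypothesis a_gt0 : forall m, m < n -> 0 < a m.
Hypothesis b_gt0 : forall m, m < n -> 0 < b m.
Hypothesis edge : forall m, m < n ->
  b m * X m + a m * Y m = b m * X m.+1 + a m * Y m.+1.

Lemma newton_number_polygon : newton_number R d q k =
  (1 + ((\sum_(m < n) (X m - X m.+1) * (Y m + Y m.+1))%:R
    - (X 0)%:R - (Y n)%:R) / d%:R)%R.
Proof.
have not00 : ~ LL d q k (0, 0).
  by rewrite /LL /= muln0 => h; move: k_neq0; rewrite h eqxx.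
(* Without edges the single vertex would be the origin, which is not in $\mathbb L(k)$; the same
   exclusion makes every edge level positive below. *)
have n_gt0 : 0 < n.
  rewrite lt0n; apply/eqP => n0; apply: not00.
  by have := vertex (leq0n n); rewrite Y0; move: Xn; rewrite n0 => ->.
have c_gt0 m : m < n -> 0 < b m * X m + a m * Y m.
  move=> hm.
  rewrite lt0n addn_eq0 !muln_eq0 !eqn0Ngt a_gt0// b_gt0//= -!eqn0Ngt.
  apply/negP => /andP[/eqP X0 /eqP Y0']; apply: not00.
  by have := vertex (ltnW hm); rewrite X0 Y0'.
set S := [set ((p.1)%:R : R, (p.2)%:R : R) | p in LL d q k].
pose r (u : nat -> nat) m := (u m)%:R : R.
have S_ge0 p : S p -> (0 <= p.1 /\ 0 <= p.2)%R by move=> [z _ <-].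
have S_shift1 x y : S (x, y) -> S (x + d%:R, y)%R.
  move=> [[z1 z2] Lz [<- <-]]; exists (z1 + d, z2); first exact: LL_shift1.
  by rewrite /= natrD.
have S_shift2 x y : S (x, y) -> S (x, y + d%:R)%R.
  move=> [[z1 z2] Lz [<- <-]]; exists (z1, z2 + d); first exact: LL_shift2.
  by rewrite /= natrD.
have S_vertex m : m <= n -> S (r X m, r Y m).
  by move=> hm; exists (X m, Y m) => //; exact: vertex.
have S_above p m : S p -> m < n ->
    (r b m * r X m + r a m * r Y m <= r b m * p.1 + r a m * p.2)%R.
  move=> [[z1 z2] Lz <-] hm /=; rewrite /r -!natrM -!natrD ler_nat.
  exact: supp.
have rX_anti m : m < n -> (r X m.+1 <= r X m)%R.
  by move=> hm; rewrite ler_nat X_anti.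
have rc_gt0 m : m < n -> (0 < r b m * r X m + r a m * r Y m)%R.
  by move=> hm; rewrite /r -!natrM -!natrD ltr0n c_gt0.
have redge m : m < n ->
    (r b m * r X m.+1 + r a m * r Y m.+1 = r b m * r X m + r a m * r Y m)%R.
  by move=> hm; rewrite /r -!natrM -!natrD edge.
have rY0 : r Y 0 = 0%R by rewrite /r Y0.
have rXn : r X n = 0%R by rewrite /r Xn.
have d0 : (0 < d%:R :> R)%R by rewrite ltr0n.
have ra m : m < n -> (0 < r a m)%R by move=> hm; rewrite ltr0n a_gt0.
have rb m : m < n -> (0 < r b m)%R by move=> hm; rewrite ltr0n b_gt0.
have rE : @newton_region R d q k = below n (r X) (r Y) (r a) (r b).
  exact: (closure_below_polygon d0).
rewrite /newton_number asboolF; last first.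
  by move=> E; apply: not00; rewrite E /LL /= muln0.
rewrite /newton_area /newton_len1 /newton_len2 rE.
rewrite (area_below (S := S) d0)//=.
rewrite (below_axis1 (S := S))// (below_axis2 (S := S))//.
rewrite !measure_itv0// /= natr_sum mulr_sumr; congr (1 + (_ - _ - _) / _)%R.
apply: eq_bigr => m _; rewrite mulrC divfK ?pnatr_eq0//.
by rewrite natrM natrD natrB// X_anti.
Qed.
End NewtonNumber.

End Geometry.

Local Open Scope ring_scope.

(** * The cyclic quotient and its Newton numbers *)

(** After the swap, [z] with weights $(1,q)$ acts as [z ^+ q] with weights $(1,q')$, since
    $z^{qq'}=z$. *)
Lemma quotient_ring_swapXY (C : fieldType) d q q' :
  (q * q' = 1 %[mod d])%N -> forall p : {poly {poly C}},
  quotient_ring d q' p -> quotient_ring d q (swapXY p).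
Proof.
move=> qq' p hp z x y zd.
rewrite [LHS](horner2_swapXY p (z ^+ q * y)) [RHS](horner2_swapXY p y).
have zq : (z ^+ q) ^+ d = 1 by rewrite exprAC zd expr1n.
rewrite -[RHS](hp (z ^+ q) y x zq) -exprM.
by rewrite -(expr_mod (q * q') zd) qq' expr_mod.
Qed.

Lemma quotient_isomorphic_inverse (C : fieldType) d q q' :
  (q * q' = 1 %[mod d])%N -> quotient_isomorphic C d q' d q.
Proof.
move=> qq'; exists (@swapXY C).
  split; first exact: quotient_ring_swapXY.
    by move=> u v _ _; apply: (can_inj (@swapXYK C)).
  move=> p hp; exists (swapXY p); last exact: swapXYK.
  by apply: (@quotient_ring_swapXY _ d q' q) hp; rewrite mulnC.
split=> [u v _ _|u v _ _|c].
- exact: rmorphD.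
- exact: rmorphM.
- by rewrite swapXY_polyC map_polyC.
Qed.

(** The case of a single edge, from $(u,0)$ to $(0,v)$, on which $vr+us=uv$. *)
Lemma newton_number_triangle (R : realType) d q k u v :
  (0 < d)%N -> k != 0 %[mod d] -> (0 < u)%N -> (0 < v)%N ->
  LL d q k (u, 0%N) -> LL d q k (0%N, v) ->
  (forall r s, LL d q k (r, s) -> (u * v <= v * r + u * s)%N) ->
  newton_number R d q k = ((d%:R - 1) + (u%:R - 1) * (v%:R - 1)) / d%:R.
Proof.
move=> d0 k0 u0 v0 Lu Lv supp.
rewrite (@newton_number_polygon R d q k 1 (fun m => if m is 0 then u else 0)%N
  (fun m => if m is 0 then 0 else v)%N (fun=> u) (fun=> v))//; first last.
- by move=> [|m] // _; rewrite !muln0 addn0 mulnC.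
- by move=> r s [|m] Lrs // _; rewrite muln0 addn0 mulnC; exact: supp.
- by move=> [|[|m]].
rewrite big_ord1 /= subn0 add0n natrM; field.
by rewrite pnatr_eq0 -lt0n.
Qed.

(** As $q_i$ is smaller than all earlier divisors, the digits before the $i$-th vanish and the path
    stays at $(q_i,0)$. *)
Lemma greedy_qseq d q i m : (1 <= q < d)%N -> coprime d q ->
  (i <= qlen d q)%N -> (m < i)%N ->
  greedy_rem d q (qseq d q i) m = qseq d q i /\ height d q (qseq d q i) m = 0%N.
Proof.
move=> hq hdq hi; elim: m => [|m IH] hm; first by rewrite /height big_ord0.
have [Er Eh] := IH (ltnW hm).
have lt : (qseq d q i < qseq d q m.+1)%N.
  by apply: qseq_lt => //; exact: leq_trans (ltnW hm) hi.
have Er' : greedy_rem d q (qseq d q i) m.+1 = qseq d q i.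
  have -> : greedy_rem d q (qseq d q i) m.+1 =
    (greedy_rem d q (qseq d q i) m %% qseq d q m.+1)%N by [].
  by rewrite Er modn_small.
split=> //.
rewrite heightS Eh /greedy; case: ifP => // _.
by rewrite -pred_Sn Er divn_small.
Qed.

Lemma LL_above_qseq d q i r s : (1 <= q < d)%N -> coprime d q ->
  (0 < i <= qlen d q)%N -> LL d q (qseq d q i) (r, s) ->
  (qseq d q i * qbarseq d q i <= qbarseq d q i * r + qseq d q i * s)%N.
Proof.
case: i => // i hq hdq hi Lrs.
have kd : (qseq d q i.+1 < d)%N by apply: (@qseq_lt d q hq hdq 0).
have := LL_above_edge hq hdq kd Lrs hi.
rewrite -vertex_on_edge//.
have [-> ->] := @greedy_qseq d q i.+1 i hq hdq hi (leqnn _).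
by rewrite muln0 addn0 mulnC.
Qed.

Theorem proposition2p9 (R : realType) (d q k : nat)
    (hq : (1 <= q < d)%N) (hdq : coprime d q) (hk : (k < d)%N) :
  let n := qlen d q in
  let q' := qbar d q n in
  [/\ newton_number R d q k =
        (if k == 0%N then -1
         else ((d%:R - 1) + (k%:R - 1) * ((kbar d q k)%:R - 1)) / d%:R
              - (greedy_form d q k)%:~R),
      (q * q' = 1 %[mod d])%N,
      quotient_isomorphic R[i] d q' d q &
      forall i : nat, (1 <= i <= n)%N ->
        newton_number R d q (qseq d q i) = newton_number R d q' (qbar d q i) /\
        newton_number R d q' (qbar d q i) =
          ((d%:R - 1) + ((qseq d q i)%:R - 1) * ((qbar d q i)%:R - 1)) / d%:R].
Proof.
move=> n q'.
have d0 : (0 < d)%N by lia.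
have dR : d%:R != 0 :> R by rewrite pnatr_eq0 -lt0n.
have qq' : (q * q' = 1 %[mod d])%N.
  by rewrite /q' qbarE// qseq_qbarseq_mod// qseq_qlen.
have neq0 j : (0 < j < d)%N -> j != 0 %[mod d].
  by move=> hj; rewrite mod0n modn_small; lia.
split=> //; last first.
- move=> i hi; have hin : (i <= n)%N by case/andP: hi.
  have qi0 : (0 < qseq d q i)%N by rewrite qseq_gt0.
  have qid : (qseq d q i < d)%N.
    by apply: (@qseq_lt d q hq hdq 0) => //; case/andP: hi.
  have bi0 : (0 < qbarseq d q i)%N by apply: qbarseq_gt0 => //; lia.
  have bid := @qbarseq_ltd d q hq hdq i hin.
  have qb := @qseq_qbarseq_mod d q hq hdq i hin.
  rewrite qbarE//.
  (* Both boundaries are one edge, with the roles of $q_i$ and $\bar q_i$ exchanged. *)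
  suff [-> ->] : newton_number R d q (qseq d q i) =
     ((d%:R - 1) + ((qseq d q i)%:R - 1) * ((qbarseq d q i)%:R - 1)) / d%:R /\
     newton_number R d q' (qbarseq d q i) =
     ((d%:R - 1) + ((qbarseq d q i)%:R - 1) * ((qseq d q i)%:R - 1)) / d%:R.
    by rewrite [in (_ - 1) * _]mulrC.
  split; apply: newton_number_triangle => //.
  + by apply: neq0; rewrite qi0.
  + by rewrite /LL /= muln0 addn0.
  + by move=> r s; exact: LL_above_qseq.
  + by apply: neq0; rewrite bi0.
  + by rewrite /LL /= muln0 addn0.
  + rewrite /LL /= add0n -modnMmr -qb modnMmr mulnCA mulnA.
    by rewrite -modnMml qq' modnMml mul1n.
  (* Multiplying the congruence by $q$ shows that swapping coordinates carries this lattice set for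
     $q'$ into $\mathbb L(q_i)$ for $q$, where the bound is known. *)
  + move=> r s Lrs; rewrite mulnC addnC; apply: LL_above_qseq => //.
    rewrite /LL /= -qb -[in RHS]modnMmr -Lrs /= modnMmr mulnDr mulnA.
    by rewrite addnC -modnDmr -[in RHS]modnDmr -modnMml qq' modnMml mul1n.
- exact: quotient_isomorphic_inverse.
have [->|k0] := eqVneq k 0%N; first by rewrite /newton_number asboolT.
rewrite (@newton_number_polygon R d q k n (greedy_rem d q k) (height d q k)
  (fun m => qseq d q m.+1) (fun m => qbarseq d q m.+1))//.
- have -> : (\sum_(m < n) (greedy_rem d q k m - greedy_rem d q k m.+1) *
       (height d q k m + height d q k m.+1) =
     \sum_(j < n) greedy d q k j.+1 * qseq d q j.+1 *
       (height d q k j + height d q k j.+1))%N.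
    by apply: eq_bigr => j _; rewrite greedy_remS// addnK.
  have := area_identity hq hdq hk (leqnn n).
  rewrite greedy_rem_qlen// mul0n addn0 height_qlen// greedy_formE//.
  move=> /(congr1 (fun x => x%:R : R)).
  rewrite natrD !natrM; set S := _%:R; set F := (greedy_sum _ _ _ _)%:R => E.
  rewrite -[_%:~R]/F.
  (* [S] is twice the area; at $m=n$ the remainder is 0 and the height is $\bar k$. *)
  have -> : S = k%:R * (kbar d q k)%:R - d%:R * F by rewrite -E addrK.
  by field.
- by apply: neq0; rewrite lt0n k0.
- by move=> m hm; exact: vertex_LL.
- by move=> r s m Lrs hm; rewrite vertex_on_edge//; exact: LL_above_edge.
- by rewrite /height big_ord0.
- exact: greedy_rem_qlen.
- by move=> m hm; rewrite [X in (_ <= X)%N]greedy_remS// leq_addl.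
- by move=> m hm; rewrite qseq_gt0.
- by move=> m hm; apply: qbarseq_gt0 => //; lia.
- by move=> m hm; exact: vertex_on_edge.
Qed.
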